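(* Let $\lambda>0$, $s\in[0,1)$ and $\theta\in(0,1)$. Consider, for each $N\in\mathbb{N}$, the aligned Zipf model $p_i=w_i=i^{-s}/\sum_{j=1}^N j^{-s}$, $1\le i\le N$, with quorum time $\tau^{(s)}_{N,\theta}$. Then \[ \frac{\tau^{(s)}_{N,\theta}}{N}\longrightarrow\frac{\alpha_{s,\theta}}{\lambda}\quad\text{in probability as }N\to\infty, \] where $\alpha_{s,\theta}$ is the unique solution $\alpha$ of \[ (1-s)\int_0^1 x^{-s}\Bigl(1-e^{-(1-s)\alpha x^{-s}}\Bigr)\,dx=\theta. \]
   Context: For each $N$, let $T_1,\dots,T_N$ (depending on $N$) be independent with $T_i\sim\mathrm{Exp}(\lambda p_i)$ (rate $\lambda p_i$). Discovered-mass process: $M^{(s)}_N(t)=\sum_{i=1}^N w_i\mathbf{1}_{\{T_i\le t\}}$. Quorum time: $\tau^{(s)}_{N,\theta}=\inf\{t\ge0:M^{(s)}_N(t)>\theta\}$. *)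

(* Defs.v *)
From HB Require Import structures.
From mathcomp Require Import all_boot all_order all_algebra.
From mathcomp Require Import all_classical all_reals all_analysis.

Set Implicit Arguments.
Unset Strict Implicit.
Unset Printing Implicit Defensive.

Import Order.TTheory GRing.Theory Num.Theory.
Import numFieldNormedType.Exports.

Local Open Scope classical_set_scope.
Local Open Scope ring_scope.

(* Taking some of the B i to be setT yields the product rule for every
   subfamily. *)
Definition mutually_independent (I : finType) (R : realType)
    (d : measure_display) (Omega : measurableType d) (P : probability Omega R)
    (X : I -> {RV P >-> R}) : Prop :=
  forall B : I -> set R, (forall i, measurable (B i)) ->
    P [set omega | forall i, B i (X i omega)]
      = (\prod_(i : I) P (X i @^-1` B i))%E.

(* [exponential_prob] is given by an integral, which is only meaningful on
   measurable sets; the equality is therefore restricted to those. *)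
Definition exponentially_distributed (R : realType)
    (d : measure_display) (Omega : measurableType d) (P : probability Omega R)
    (X : {RV P >-> R}) (rate : R) : Prop :=
  forall B : set R, measurable B -> distribution P X B = exponential_prob rate B.

(* The index i : 'I_N stands for the rank i.+1 of the 1-based convention. *)
Definition zipf (R : realType) (s : R) (N : nat) (i : 'I_N) : R :=
  (i.+1%:R `^ (- s)) / \sum_(j < N) (j.+1%:R `^ (- s)).

Definition discovered_mass (R : realType) (N : nat) (Omega : Type)
    (w : 'I_N -> R) (T : 'I_N -> Omega -> R) (t : R) (omega : Omega) : R :=
  \sum_(i < N) w i * \1_[set x | T i x <= t] omega.

(* The infimum is that of R: when the total weight exceeds theta, the set is
   nonempty (take t = max(0, T_1, ..., T_N)) and it is bounded below by 0. *)
Definition quorum_time (R : realType) (N : nat) (Omega : Type)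
    (w : 'I_N -> R) (T : 'I_N -> Omega -> R) (theta : R) (omega : Omega) : R :=
  inf [set t : R | 0 <= t /\ theta < discovered_mass w T t omega].

(* Convergence in probability to a constant of random variables X N, each
   living on its own probability space. *)
Definition cvg_in_probability (R : realType) (d : nat -> measure_display)
    (Omega : forall N, measurableType (d N))
    (P : forall N, probability (Omega N) R)
    (X : forall N, Omega N -> R) (l : R) : Prop :=
  (forall N, measurable_fun setT (X N)) /\
  forall eps : R, 0 < eps ->
    P N [set omega | eps < `|X N omega - l|] @[N --> \oo] --> 0%E.

(* The integral is extended-real valued: it is -oo for s > 0 and a < 0, so the
   equation implicitly rules out such a. *)
Definition quorum_equation (R : realType) (s theta a : R) : Prop :=
  ((1 - s)%:E * \int[lebesgue_measure]_(x in `[0%R, 1%R])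
     (x `^ (- s) * (1 - expR (- ((1 - s) * a * x `^ (- s)))))%:E = theta%:E)%E.

(* Main.v *)
(* At time t = a N / lambda the discovered mass has mean
   G_N(a) = sum_i w_i (1 - exp (- a N w_i)) and variance at most sum_i w_i^2,
   which is at most N^(s - 1); by Chebyshev it concentrates around G_N(a).
   With h = N^(1 - s) / sum_j j^(-s), one has N w_i = h (i/N)^(-s), so G_N(a) is h
   times a Riemann sum of the decreasing function x^(-s) (1 - exp (- a h x^(-s))).
   Comparing Riemann sums of decreasing functions with integrals gives
   1 - s <= h <= (1 - s) / (1 - N^(s - 1)), and then, with g(a) the left-hand side
   of the quorum equation and using g(k a) <= k g(a) for k >= 1,
   g(a) - N^(s - 1) <= G_N(a) <= g(a) / (1 - N^(s - 1))^2.
   Since g is continuous and strictly increasing from 0 to 1, alpha exists and the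
   mass at time (alpha +- lambda eps) N / lambda is on either side of theta with
   probability tending to 1. *)

Require Import Defs.
From HB Require Import structures.
From mathcomp Require Import all_boot all_order all_algebra.
From mathcomp Require Import all_classical all_reals all_analysis.
From mathcomp Require Import measurable_realfun ring lra.
Import Order.TTheory GRing.Theory Num.Theory.
Import numFieldNormedType.Exports.

Set Implicit Arguments.
Unset Strict Implicit.
Unset Printing Implicit Defensive.

Local Open Scope classical_set_scope.
Local Open Scope ring_scope.

(** * Integrals of decreasing functions and Riemann sums *)

Lemma integral_itv_splitoc (R : realType) (a b c : R) (f : R -> R) :
  a <= b -> b <= c -> measurable_fun setT f -> (forall x, 0 <= f x) ->
  (\int[lebesgue_measure]_(x in `]a, c]) (f x)%:E =
   \int[lebesgue_measure]_(x in `]a, b]) (f x)%:E +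
   \int[lebesgue_measure]_(x in `]b, c]) (f x)%:E)%E.
Proof.
move=> ab bc mf f0.
have -> : `]a, c]%classic = `]a, b]%classic `|` `]b, c]%classic :> set R.
  apply/seteqP; split=> x /=; rewrite !in_itv/=.
    by move=> /andP[ax xc]; case: (leP x b) => xb; [left|right]; apply/andP.
  move=> [/andP[ax xb]|/andP[bx xc]]; apply/andP; split=> //; first exact: le_trans bc.
  exact: le_lt_trans bx.
rewrite ge0_integral_setU//.
- exact/measurable_EFinP/measurable_funTS.
- by move=> x _; rewrite lee_fin.
- apply/disj_setPS => x /= []; rewrite !in_itv/= => /andP[_ xb] /andP[bx _].
  by move: (lt_le_trans bx xb); rewrite ltxx.
Qed.

Lemma integral_oc_cst (R : realType) (a b k : R) : a <= b ->
  (\int[lebesgue_measure]_(x in `]a, b]) k%:E = (k * (b - a))%:E :> \bar R)%E.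
Proof.
move=> ab; rewrite integral_cst//= lebesgue_measure_itv/= lte_fin.
by move: ab; rewrite le_eqVlt => /predU1P[->|->]; rewrite ?ltxx ?subrr ?mulr0 ?mule0//.
Qed.

(** On each cell []k e, (k+1) e]] the value at the right endpoint is the smallest one. Monotonicity
    is asked only at positive points, so [f] may blow up at 0. *)
Lemma antitone_sum_le_integral (R : realType) (f : R -> R) (e : R) :
  0 < e -> measurable_fun setT f -> (forall x, 0 <= f x) ->
  (forall x y, 0 < x -> x <= y -> f y <= f x) ->
  forall k, ((\sum_(i < k) f (i.+1%:R * e) * e)%:E <=
    \int[lebesgue_measure]_(x in `]0%R, (k%:R * e)%R]) (f x)%:E)%E.
Proof.
move=> e0 mf f0 anti; elim=> [|k IH].
  by rewrite big_ord0; apply: integral_ge0 => x _; rewrite lee_fin.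
have kk : k%:R * e <= k.+1%:R * e by rewrite ler_pM2r// ler_nat.
rewrite big_ord_recr/= (@integral_itv_splitoc _ _ (k%:R * e))//; last first.
  by rewrite mulr_ge0// ltW.
rewrite EFinD leeD//.
have -> : f (k.+1%:R * e) * e = f (k.+1%:R * e) * (k.+1%:R * e - k%:R * e).
  by rewrite -natr1; ring.
rewrite -integral_oc_cst//; apply: ge0_le_integral => //.
- by move=> x _; rewrite lee_fin.
- exact/measurable_EFinP/measurable_funTS.
- move=> x /=; rewrite in_itv/= => /andP[kx xk]; rewrite lee_fin anti//.
  by apply: le_lt_trans kx; rewrite mulr_ge0// ltW.
Qed.

(** The sample at [(i+1) e] is now the left endpoint, hence the largest value, of the next cell. The
    shift leaves out the cell []0, e]], which must be estimated separately. *)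
Lemma integral_le_antitone_sum (R : realType) (f : R -> R) (e : R) :
  0 < e -> measurable_fun setT f -> (forall x, 0 <= f x) ->
  (forall x y, 0 < x -> x <= y -> f y <= f x) ->
  forall k, (\int[lebesgue_measure]_(x in `]e, (k.+1%:R * e)%R]) (f x)%:E <=
    (\sum_(i < k) f (i.+1%:R * e) * e)%:E)%E.
Proof.
move=> e0 mf f0 anti; elim=> [|k IH].
  by rewrite big_ord0 mul1r set_itvoc0 integral_set0.
have kk : k.+1%:R * e <= k.+2%:R * e by rewrite ler_pM2r// ler_nat.
rewrite big_ord_recr/= (@integral_itv_splitoc _ _ (k.+1%:R * e))//; last first.
  by rewrite ler_peMl ?ler1n// ltW.
rewrite EFinD leeD//.
have -> : f (k.+1%:R * e) * e = f (k.+1%:R * e) * (k.+2%:R * e - k.+1%:R * e).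
  by rewrite -(natr1 k.+1); ring.
rewrite -integral_oc_cst//; apply: ge0_le_integral => //.
- by move=> x _; rewrite lee_fin.
- exact/measurable_EFinP/measurable_funTS.
- move=> x /=; rewrite in_itv/= => /andP[kx xk]; rewrite lee_fin anti// ?(ltW kx)//.
  by rewrite mulr_gt0.
Qed.

Lemma powRN_cvg0 (R : realType) (b : R) : 0 < b ->
  n%:R `^ (- b) @[n --> \oo] --> (0 : R).
Proof.
move=> b0; rewrite -cvg_shiftS/=.
have := (cvg_at_rightP _ _ _).1 (powR_cvg0 b0) _ (conj (@harmonic_gt0 R) cvg_harmonic).
by apply: cvg_trans; apply: near_eq_cvg; near=> n; rewrite /= -powR_inv1// -powRrM mulN1r.
Unshelve. all: by end_near. Qed.

(** The integrand may be singular at 0, so the fundamental theorem of calculus is applied on compact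
    intervals away from 0, and monotone convergence gives the limit. *)
Lemma integral_powRN (R : realType) (r e : R) : r < 1 -> 0 < e ->
  (\int[lebesgue_measure]_(x in `]0%R, e]) (x `^ (- r))%:E =
   (e `^ (1 - r) / (1 - r))%:E)%E.
Proof.
move=> r1 e0.
have r1' : 0 < 1 - r by rewrite subr_gt0.
(* Dividing by [n.+2] rather than [n.+1] keeps every interval nondegenerate. *)
pose F n : set R := `[e / n.+2%:R, e]%classic.
have en0 n : 0 < e / n.+2%:R by rewrite divr_gt0.
have en1 n : e / n.+2%:R < e by rewrite ltr_pdivrMr// ltr_pMr// ltr1n.
have UF : `]0%R, e]%classic = \bigcup_n F n.
  apply/seteqP; split=> x /=; rewrite in_itv/=.
    move=> /andP[x0 xe]; exists (Num.truncn (e / x)) => //; rewrite /F/= in_itv/= xe andbT.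
    rewrite ler_pdivrMr// mulrC -ler_pdivrMr//.
    by apply: le_trans (ltW (truncnS_gt _)) _; rewrite ler_nat.
  move=> [n _]; rewrite /F/= in_itv/= => /andP[xn ->]; rewrite andbT.
  exact: lt_le_trans (en0 n) xn.
have I n : (\int[lebesgue_measure]_(x in F n) (x `^ (- r))%:E =
   (e `^ (1 - r) / (1 - r))%:E - ((e / n.+2%:R) `^ (1 - r) / (1 - r))%:E)%E.
  have D (x : R) : 0 < x ->
      is_derive x 1 (fun x : R^o => x `^ (1 - r) / (1 - r) : R^o) (x `^ (- r)).
    move=> x0; have H := is_derive1_powR (1 - r) x0.
    have -> : x `^ (- r) = (1 - r)^-1 *: ((1 - r) * x `^ (1 - r - 1)).
      by rewrite /GRing.scale/= mulKf ?gt_eqF//; congr (_ `^ _); ring.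
    have -> : (fun x : R => x `^ (1 - r) / (1 - r)) =
        (1 - r)^-1 \*: ((fun y : R => y `^ (1 - r)) : R -> R^o).
      by apply/funext => y; rewrite /GRing.scale/= mulrC.
    exact: is_deriveZ.
  have C (x : R) : 0 < x -> {for x, continuous (fun x : R => x `^ (- r))}.
    move=> x0; apply: differentiable_continuous; apply/derivable1_diffP.
    by apply: derivable_powR; rewrite in_itv/= x0.
  have C' (x : R) : 0 < x -> {for x, continuous (fun x : R => x `^ (1 - r) / (1 - r))}.
    move=> x0; apply: differentiable_continuous; apply/derivable1_diffP.
    by have := D _ x0; case.
  apply: (@continuous_FTC2 _ _ (fun x => x `^ (1 - r) / (1 - r))) => //.
  - apply: continuous_in_subspaceT => x; rewrite inE/= in_itv/= => /andP[ex _].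
    by apply: C; exact: lt_le_trans ex.
  - split.
    + move=> x; rewrite in_itv/= => /andP[ex _].
      by have := D _ (lt_trans (en0 n) ex); case.
    + by apply: cvg_at_right_filter; exact: C'.
    + by apply: cvg_at_left_filter; exact: C'.
  - move=> x; rewrite in_itv/= => /andP[ex _]; rewrite derive1E.
    by have [_ ->] := D _ (lt_trans (en0 n) ex).
have : (\int[lebesgue_measure]_(x in F n) (x `^ (- r))%:E @[n --> \oo] -->
        \int[lebesgue_measure]_(x in \bigcup_n F n) (x `^ (- r))%:E)%E.
  apply: ge0_nondecreasing_set_cvg_integral => //.
  - move=> m n mn; rewrite subsetEset => x; rewrite /F/= !in_itv/= => /andP[h ->].
    rewrite andbT; apply: le_trans h; rewrite ler_pM2l// lef_pV2 ?posrE//.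
    by rewrite ler_nat !ltnS.
  - by move=> n; exact: measurable_itv.
  - by move=> n; apply/measurable_EFinP; apply: measurable_funTS.
  - by move=> n x _; rewrite lee_fin powR_ge0.
rewrite -UF => /cvg_lim <-//; apply/cvg_lim => //.
rewrite (eq_cvg _ _ I).
suff L : ((e `^ (1 - r) / (1 - r))%:E - ((e / n.+2%:R) `^ (1 - r) / (1 - r))%:E
    @[n --> \oo] --> (e `^ (1 - r) / (1 - r))%:E - 0%:E)%E by rewrite sube0 in L.
apply: cvgeB => //; first exact: cvg_cst.
apply: cvg_EFin; first by near=> n.
have -> : fine \o (fun n => ((e / n.+2%:R) `^ (1 - r) / (1 - r))%:E) =
    (fun n => (e `^ (1 - r) / (1 - r)) * n.+2%:R `^ (- (1 - r))).
  apply/funext => n /=.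
  by rewrite powRM ?invr_ge0 ?(ltW e0)// -powR_inv1// -powRrM mulN1r mulrAC.
rewrite -(mulr0 (e `^ (1 - r) / (1 - r))); apply: cvgM; first exact: cvg_cst.
have := @powRN_cvg0 R (1 - r) r1'.
by rewrite -cvg_shiftS -cvg_shiftS.
Unshelve. all: by end_near. Qed.

(** * The limiting mass *)

Lemma onem_expRN_ge0 (R : realType) (u : R) : 0 <= u -> 0 <= 1 - expR (- u).
Proof. by move=> u0; rewrite subr_ge0 expR_le1 oppr_le0. Qed.

Lemma onem_expRN_le (R : realType) (u v : R) : u <= v ->
  1 - expR (- u) <= 1 - expR (- v).
Proof. by move=> uv; rewrite lerB// ler_expR lerN2. Qed.

Lemma onem_expRN_le1 (R : realType) (u : R) : 1 - expR (- u) <= 1.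
Proof. by rewrite gerBl expR_ge0. Qed.

(** This is concavity of 1 - exp(-u), which vanishes at 0. It follows from exp(-(k-1)u) >= 1 -
    (k-1)u and u exp(-u) <= 1 - exp(-u). *)
Lemma onem_expRN_scale (R : realType) (k u : R) : 1 <= k -> 0 <= u ->
  1 - expR (- (k * u)) <= k * (1 - expR (- u)).
Proof.
move=> k1 u0.
have -> : - (k * u) = - u + - ((k - 1) * u) by ring.
have H1 := expR_ge1Dx (- ((k - 1) * u)).
have H2 : 1 - expR (- u) >= u * expR (- u).
  have := expR_ge1Dx u; rewrite -(ler_pM2r (expR_gt0 (- u))) expRxMexpNx_1; lra.
have H3 := expR_ge0 (- u).
rewrite expRD.
have H4 : expR (- u) * (1 + - ((k - 1) * u)) <= expR (- u) * expR (- ((k - 1) * u)).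
  by rewrite ler_wpM2l.
have H5 : (k - 1) * (u * expR (- u)) <= (k - 1) * (1 - expR (- u)).
  by rewrite ler_wpM2l// subr_ge0.
nra.
Qed.

Lemma onem_expRN_subadd (R : realType) (u v : R) : 0 <= u -> 0 <= v ->
  1 - expR (- (u + v)) <= (1 - expR (- u)) + (1 - expR (- v)).
Proof.
move=> /onem_expRN_ge0 u0 /onem_expRN_ge0 v0; rewrite opprD expRD.
by have := mulr_ge0 u0 v0; lra.
Qed.

(** For u <= 1 the bound passes through u <= u^b, for u > 1 through 1 <= u^b. A power of u yields an
    explicitly integrable majorant of the kernel. *)
Lemma onem_expRN_le_powR (R : realType) (b u : R) : 0 < b -> b <= 1 -> 0 <= u ->
  1 - expR (- u) <= u `^ b.
Proof.
move=> b0 b1; rewrite le_eqVlt => /predU1P[<-|u0].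
  by rewrite oppr0 expR0 subrr powR_ge0.
have [u1|u1] := leP u 1.
  apply: (@le_trans _ _ u); last by rewrite ger1_powR// u0.
  by have := expR_ge1Dx (- u); lra.
apply: le_trans (onem_expRN_le1 _) _.
by rewrite -(powRr0 u); apply: ler_powR; exact: ltW.
Qed.

(** The parameter [c] is free because the limit uses [(1 - s) * a], while the finite sums use a
    value depending on N. *)
Definition quorum_kernel (R : realType) (s c x : R) : R :=
  x `^ (- s) * (1 - expR (- (c * x `^ (- s)))).

(** The endpoint 0 is dropped: the power takes the value 0 there when s > 0, which breaks
    monotonicity. *)
Definition kernel_integral (R : realType) (s c : R) : \bar R :=
  (\int[lebesgue_measure]_(x in `]0%R, 1%R]) (quorum_kernel s c x)%:E)%E.

Lemma quorum_kernel_ge0 (R : realType) (s c x : R) : 0 <= c ->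
  0 <= quorum_kernel s c x.
Proof.
by move=> c0; rewrite mulr_ge0 ?powR_ge0// onem_expRN_ge0// mulr_ge0// powR_ge0.
Qed.

Lemma measurable_quorum_kernel (R : realType) (s c : R) :
  measurable_fun setT (quorum_kernel s c).
Proof.
apply: measurable_funM; first exact: measurable_powR.
apply: measurable_funB => //.
apply: measurableT_comp; first exact: measurable_expR.
apply: measurableT_comp => //.
by apply: measurable_funM => //; exact: measurable_powR.
Qed.

Lemma powRN_le (R : realType) (s x y : R) : 0 <= s -> 0 < x -> x <= y ->
  y `^ (- s) <= x `^ (- s).
Proof.
move=> s0 x0 xy; rewrite !powRN lef_pV2 ?posrE ?powR_gt0 ?(lt_le_trans x0)//.
by rewrite ge0_ler_powR// nnegrE ltW// (lt_le_trans x0).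
Qed.

Lemma powRN_ge1 (R : realType) (s x : R) : 0 <= s -> 0 < x -> x <= 1 ->
  1 <= x `^ (- s).
Proof. by move=> s0 x0 x1; have := powRN_le s0 x0 x1; rewrite powR1. Qed.

Lemma quorum_kernel_antitone (R : realType) (s c x y : R) : 0 <= s -> 0 <= c ->
  0 < x -> x <= y -> quorum_kernel s c y <= quorum_kernel s c x.
Proof.
move=> s0 c0 x0 xy; have H := powRN_le s0 x0 xy.
apply: ler_pM; rewrite ?powR_ge0//.
  by rewrite onem_expRN_ge0// mulr_ge0// powR_ge0.
by apply: onem_expRN_le; rewrite ler_wpM2l.
Qed.

Lemma kernel_integral_le (R : realType) (s c : R) (F : R -> R) : 0 <= c ->
  measurable_fun setT F -> (forall x, 0 < x -> x <= 1 -> quorum_kernel s c x <= F x) ->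
  (kernel_integral s c <= \int[lebesgue_measure]_(x in `]0%R, 1%R]) (F x)%:E)%E.
Proof.
move=> c0 mF h; apply: ge0_le_integral => //.
- by move=> x _; rewrite lee_fin quorum_kernel_ge0.
- by apply/measurable_EFinP/measurable_funTS; exact: measurable_quorum_kernel.
- exact/measurable_EFinP/measurable_funTS.
- by move=> x /=; rewrite in_itv/= lee_fin => /andP[x0 x1]; exact: h.
Qed.

Lemma kernel_integral_ub (R : realType) (s c : R) : s < 1 -> 0 <= c ->
  (kernel_integral s c <= ((1 - s)^-1)%:E)%E.
Proof.
move=> s1 c0.
have <- : (\int[lebesgue_measure]_(x in `]0%R, 1%R]) (x `^ (- s))%:E = ((1 - s)^-1)%:E)%E.
  by rewrite integral_powRN// powR1 div1r.
apply: (@kernel_integral_le _ _ _ (fun x => x `^ (- s))) => //.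
by move=> x x0 x1; rewrite ler_piMr ?powR_ge0// onem_expRN_le1.
Qed.

Lemma kernel_integral_ge0 (R : realType) (s c : R) : 0 <= c ->
  (0 <= kernel_integral s c)%E.
Proof. by move=> c0; apply: integral_ge0 => x _; rewrite lee_fin quorum_kernel_ge0. Qed.

Lemma kernel_integral_fin (R : realType) (s c : R) : s < 1 -> 0 <= c ->
  kernel_integral s c \is a fin_num.
Proof.
move=> s1 c0; rewrite ge0_fin_numE ?kernel_integral_ge0//.
by apply: le_lt_trans (kernel_integral_ub s1 c0) _; rewrite ltry.
Qed.

(* Left-hand side of the quorum equation; only used for [a >= 0], where the
   integral is finite and [fine] is harmless. *)
Definition limit_mass (R : realType) (s a : R) : R :=
  (1 - s) * fine (kernel_integral s ((1 - s) * a)).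

Section limit_mass_theory.
Context {R : realType} (s : R).
Hypotheses (s0 : 0 <= s) (s1 : s < 1).
Implicit Types a b : R.

Let os0 : 0 < 1 - s. Proof. by rewrite subr_gt0. Qed.

Let ge0 a : 0 <= a -> 0 <= (1 - s) * a.
Proof. by move=> a0; rewrite mulr_ge0// ltW. Qed.

Lemma limit_massE a : 0 <= a ->
  ((1 - s)%:E * kernel_integral s ((1 - s) * a))%E = (limit_mass s a)%:E.
Proof. by move=> a0; rewrite EFinM fineK// kernel_integral_fin// ge0. Qed.

Lemma limit_mass_le_integral a (F : R -> R) (I : R) : 0 <= a ->
  measurable_fun setT F ->
  (forall x, 0 < x -> x <= 1 -> quorum_kernel s ((1 - s) * a) x <= F x) ->
  (\int[lebesgue_measure]_(x in `]0%R, 1%R]) (F x)%:E = I%:E)%E ->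
  limit_mass s a <= (1 - s) * I.
Proof.
move=> a0 mF h e; rewrite -lee_fin -limit_massE// EFinM -e lee_wpmul2l//.
  by rewrite lee_fin ltW.
by apply: kernel_integral_le => //; exact: ge0.
Qed.

Lemma limit_mass_le a b : 0 <= a -> a <= b -> limit_mass s a <= limit_mass s b.
Proof.
move=> a0 ab; have b0 := le_trans a0 ab.
apply: (@limit_mass_le_integral _ (quorum_kernel s ((1 - s) * b))) => //.
- exact: measurable_quorum_kernel.
- move=> x x0 x1; rewrite ler_wpM2l ?powR_ge0// onem_expRN_le//.
  by rewrite ler_wpM2r ?powR_ge0// ler_wpM2l// ltW.
- by rewrite fineK// kernel_integral_fin// ge0.
Qed.

(** Concavity in [a], inherited pointwise from the kernel. It converts an error in the parameter
    into a multiplicative error on the mass. *)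
Lemma limit_mass_scale k a : 1 <= k -> 0 <= a ->
  limit_mass s (k * a) <= k * limit_mass s a.
Proof.
move=> k1 a0; have k0 : 0 <= k by rewrite (le_trans _ k1).
rewrite [X in _ <= X]mulrCA.
apply: (@limit_mass_le_integral _ (fun x => k * quorum_kernel s ((1 - s) * a) x)).
- by rewrite mulr_ge0.
- by apply: measurable_funM => //; exact: measurable_quorum_kernel.
- move=> x x0 x1; rewrite /quorum_kernel (mulrCA k) ler_wpM2l ?powR_ge0//.
  rewrite (mulrCA _ k) -(mulrA k); apply: onem_expRN_scale => //.
  by rewrite mulr_ge0 ?powR_ge0// ge0.
- under eq_integral do rewrite EFinM.
  rewrite ge0_integralZl_EFin//.
  + by rewrite EFinM fineK// kernel_integral_fin// ge0.
  + by move=> x _; rewrite lee_fin quorum_kernel_ge0// ge0.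
  + by apply/measurable_EFinP/measurable_funTS; exact: measurable_quorum_kernel.
Qed.

(** With smallness near 0, subadditivity reduces continuity everywhere to continuity at 0. *)
Lemma limit_mass_subadd a b : 0 <= a -> 0 <= b ->
  limit_mass s (a + b) <= limit_mass s a + limit_mass s b.
Proof.
move=> a0 b0; rewrite -mulrDr.
apply: (@limit_mass_le_integral _ (fun x => quorum_kernel s ((1 - s) * a) x +
  quorum_kernel s ((1 - s) * b) x)).
- by rewrite addr_ge0.
- by apply: measurable_funD; exact: measurable_quorum_kernel.
- move=> x x0 x1; rewrite /quorum_kernel -mulrDr ler_wpM2l ?powR_ge0//.
  by rewrite mulrDr mulrDl; apply: onem_expRN_subadd; rewrite mulr_ge0 ?powR_ge0// ge0.
- under eq_integral do rewrite EFinD.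
  rewrite ge0_integralD//.
  + by rewrite EFinD !fineK// kernel_integral_fin// ge0.
  + by move=> x _; rewrite lee_fin quorum_kernel_ge0// ge0.
  + by apply/measurable_EFinP/measurable_funTS; exact: measurable_quorum_kernel.
  + by move=> x _; rewrite lee_fin quorum_kernel_ge0// ge0.
  + by apply/measurable_EFinP/measurable_funTS; exact: measurable_quorum_kernel.
Qed.

(* The exponent 1 - s keeps the majorant x^(-s) (a x^(-s))^(1 - s) integrable:
   s + s (1 - s) = 1 - (1 - s)^2 < 1. *)
Lemma limit_mass_le_powR a : 0 <= a ->
  limit_mass s a <= (1 - s) * (((1 - s) * a) `^ (1 - s) * (1 - s) ^- 2).
Proof.
move=> a0; have s2 : s * (2 - s) < 1.
  by have := mulr_gt0 os0 os0; lra.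
apply: (@limit_mass_le_integral _ (fun x => ((1 - s) * a) `^ (1 - s) * x `^ (- (s * (2 - s))))) => //.
- by apply: measurable_funM => //; exact: measurable_powR.
- move=> x x0 x1; rewrite /quorum_kernel.
  have -> : - (s * (2 - s)) = - s + - s * (1 - s) by ring.
  rewrite [x `^ (_ + _)]powRD; last by rewrite (gt_eqF x0) implybT.
  rewrite (powRrM _ _ (1 - s)) mulrCA ler_wpM2l ?powR_ge0//.
  rewrite -powRM ?powR_ge0 ?ge0//; apply: onem_expRN_le_powR => //.
    by rewrite gerBl.
  by rewrite mulr_ge0 ?powR_ge0 ?ge0.
- under eq_integral do rewrite EFinM.
  rewrite ge0_integralZl_EFin ?powR_ge0//.
  + rewrite integral_powRN// powR1 div1r -EFinM; congr (_ * _^-1)%:E; ring.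
  + by move=> x _; rewrite lee_fin powR_ge0.
  + by apply/measurable_EFinP/measurable_funTS; exact: measurable_powR.
Qed.

Lemma limit_mass_small e : 0 < e -> exists2 a, 0 < a & limit_mass s a < e.
Proof.
move=> e0.
pose C := (1 - s) * (1 - s) `^ (1 - s) * (1 - s) ^- 2.
have C0 : 0 < C by rewrite !mulr_gt0 ?powR_gt0// invr_gt0 exprn_gt0.
have eC : 0 < e / 2 / C by rewrite divr_gt0// divr_gt0.
(* This solves C a^(1-s) = e/2, where C a^(1-s) is the bound of [limit_mass_le_powR]. *)
exists ((e / 2 / C) `^ (1 - s)^-1); first by rewrite powR_gt0.
apply: le_lt_trans (limit_mass_le_powR (powR_ge0 _ _)) _.
rewrite powRM ?powR_ge0 ?(ltW os0)//.
rewrite -powRrM mulVf ?gt_eqF// powRr1 ?(ltW eC)//.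
have -> : (1 - s) * ((1 - s) `^ (1 - s) * (e / 2 / C) / (1 - s) ^+ 2) = C * (e / 2 / C).
  by rewrite /C; ring.
rewrite mulrC divfK ?gt_eqF//; lra.
Qed.

(** Since x^(-s) >= 1 on ]0, 1], it can be replaced by 1 inside the exponential, and (1-s) x^(-s)
    has integral 1. Hence the mass exceeds any level below 1 for large [a]. *)
Lemma limit_mass_lb a : 0 <= a -> 1 - expR (- ((1 - s) * a)) <= limit_mass s a.
Proof.
move=> a0; rewrite -lee_fin -limit_massE//.
have h : 0 <= 1 - expR (- ((1 - s) * a)) by rewrite onem_expRN_ge0// ge0.
have <- : ((1 - s)%:E * \int[lebesgue_measure]_(x in `]0%R, 1%R])
   ((1 - expR (- ((1 - s) * a)))%:E * (x `^ (- s))%:E) =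
   (1 - expR (- ((1 - s) * a)))%:E)%E.
  rewrite ge0_integralZl_EFin//.
  + rewrite integral_powRN// powR1 div1r -!EFinM; congr (_%:E).
    by rewrite mulrCA mulfV ?mulr1// gt_eqF.
  + by move=> x _; rewrite lee_fin powR_ge0.
  + by apply/measurable_EFinP/measurable_funTS; exact: measurable_powR.
rewrite lee_wpmul2l ?lee_fin ?(ltW os0)//; apply: ge0_le_integral => //.
- by move=> x _; rewrite mule_ge0// lee_fin ?powR_ge0.
- apply: emeasurable_funM => //.
  by apply/measurable_EFinP/measurable_funTS; exact: measurable_powR.
- by apply/measurable_EFinP/measurable_funTS; exact: measurable_quorum_kernel.
- move=> x /=; rewrite in_itv/= -EFinM lee_fin => /andP[x0 x1].
  rewrite mulrC ler_wpM2l ?powR_ge0// onem_expRN_le//.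
  by rewrite ler_peMr ?ge0// powRN_ge1.
Qed.

(** On ]1/2, 1] one has 1 <= x^(-s) <= 2, so the two kernels differ by at least a positive constant
    [k]; on ]0, 1/2] weak monotonicity is enough. *)
Lemma limit_mass_lt a b : 0 <= a -> a < b -> limit_mass s a < limit_mass s b.
Proof.
move=> a0 ab; have b0 := le_trans a0 (ltW ab).
(* With y = x^(-s), the kernel gap is y exp(-(1-s)ay) (1 - exp(-(1-s)(b-a)y)); the worst cases are y
   = 2 in the first exponential and y = 1 elsewhere. *)
pose k := expR (- ((1 - s) * a * 2)) * (1 - expR (- ((1 - s) * (b - a)))).
have k0 : 0 < k.
  by rewrite mulr_gt0 ?expR_gt0// subr_gt0 expR_lt1 oppr_lt0 mulr_gt0// subr_gt0.
rewrite -lte_fin -!limit_massE// lte_pmul2l ?lte_fin//.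
have hh : 0 <= 2^-1 :> R by [].
have hh1 : 2^-1 <= 1 :> R by lra.
have split2 c : 0 <= c -> kernel_integral s c =
  (\int[lebesgue_measure]_(x in `]0%R, 2^-1%R]) (quorum_kernel s c x)%:E +
   \int[lebesgue_measure]_(x in `]2^-1%R, 1%R]) (quorum_kernel s c x)%:E)%E.
  move=> c0; apply: integral_itv_splitoc => //; first exact: measurable_quorum_kernel.
  by move=> x; exact: quorum_kernel_ge0.
have mK c (A : set R) : measurable_fun A (EFin \o quorum_kernel s c).
  by apply/measurable_EFinP/measurable_funTS; exact: measurable_quorum_kernel.
have Kab x : 0 < x -> quorum_kernel s ((1 - s) * a) x <= quorum_kernel s ((1 - s) * b) x.
  move=> x0; rewrite ler_wpM2l ?powR_ge0// onem_expRN_le//.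
  by rewrite ler_wpM2r ?powR_ge0// ler_wpM2l// ltW.
have step : (kernel_integral s ((1 - s) * a) + (k * (1 - 2^-1))%:E <=
             kernel_integral s ((1 - s) * b))%E.
  rewrite !split2 ?ge0// -addeA leeD//.
    apply: ge0_le_integral => //.
    - by move=> x _; rewrite lee_fin quorum_kernel_ge0// ge0.
    - exact: mK.
    - exact: mK.
    - by move=> x /=; rewrite in_itv/= lee_fin => /andP[x0 _]; exact: Kab.
  rewrite -integral_oc_cst// -ge0_integralD//; last 3 first.
  - by move=> x _; rewrite lee_fin quorum_kernel_ge0// ge0.
  - exact: mK.
  - by move=> x _; rewrite lee_fin ltW.
  apply: ge0_le_integral => //.
  - by move=> x _; rewrite adde_ge0// lee_fin ?quorum_kernel_ge0 ?ge0// ltW.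
  - by apply: emeasurable_funD => //; exact: mK.
  - exact: mK.
  move=> x /=; rewrite in_itv/= => /andP[x2 x1]; rewrite -EFinD lee_fin.
  have x0 : 0 < x by apply: lt_trans x2; lra.
  rewrite /quorum_kernel; set y := x `^ (- s).
  have y1 : 1 <= y by exact: powRN_ge1.
  have y2 : y <= 2.
    apply: (@le_trans _ _ (2^-1 `^ (- s))); first by apply: powRN_le => //; exact: ltW.
    rewrite -powR_inv1// -powRrM mulN1r opprK -[leRHS]powRr1//.
    by apply: ler_powR; [rewrite ler1n|exact: ltW].
  have -> : - ((1 - s) * b * y) = - ((1 - s) * a * y) + - ((1 - s) * (b - a) * y) by ring.
  rewrite expRD.
  have E1 : expR (- ((1 - s) * a * 2)) <= expR (- ((1 - s) * a * y)).
    by rewrite ler_expR lerN2 ler_wpM2l// ge0.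
  have E2 : 1 - expR (- ((1 - s) * (b - a))) <= 1 - expR (- ((1 - s) * (b - a) * y)).
    by apply: onem_expRN_le; rewrite ler_peMr// ge0// subr_ge0 ltW.
  have E3 : 0 <= 1 - expR (- ((1 - s) * (b - a))).
    by apply: onem_expRN_ge0; rewrite ge0// subr_ge0 ltW.
  have E4 : k <= expR (- ((1 - s) * a * y)) * (1 - expR (- ((1 - s) * (b - a) * y))).
    by apply: ler_pM => //; exact: expR_ge0.
  have E5 : k <= y * k by rewrite ler_peMl// ltW.
  have y0 : 0 <= y by lra.
  have E6 := ler_wpM2l y0 E4.
  by lra.
(* Finiteness of the integral makes the additive gap a strict inequality in the extended reals. *)
apply: lt_le_trans step; rewrite lteDl ?kernel_integral_fin ?ge0//.
by rewrite lte_fin mulr_gt0//; lra.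
Qed.

End limit_mass_theory.

(** * Existence and sign of solutions of the quorum equation *)

Lemma quorum_equationE (R : realType) (s theta a : R) : s < 1 -> 0 <= a ->
  quorum_equation s theta a <-> limit_mass s a = theta.
Proof.
move=> s1 a0; rewrite /quorum_equation -integral_itv_obnd_cbnd; last first.
  by apply/measurable_EFinP/measurable_funTS; exact: measurable_quorum_kernel.
by rewrite [X in X = _](limit_massE s1 a0); split=> [[]//|->].
Qed.

(** For a < 0 the integrand is nonpositive, so the left-hand side, possibly -oo, cannot equal a
    positive [theta]. *)
Lemma quorum_equation_ge0 (R : realType) (s theta a : R) : s < 1 -> 0 < theta ->
  quorum_equation s theta a -> 0 <= a.
Proof.
move=> s1 t0 e; rewrite leNgt; apply/negP => a0.
suff : (theta%:E <= 0)%E by rewrite lee_fin leNgt t0.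
rewrite -e mule_ge0_le0 ?lee_fin ?subr_ge0 ?(ltW s1)//.
under eq_integral => x _ do rewrite -[1 - expR _]opprB mulrN EFinN.
rewrite integral_ge0N ?oppe_le0 ?integral_ge0// => x _;
  rewrite lee_fin mulr_ge0 ?powR_ge0// subr_ge0.
all: rewrite -[leLHS]expR0 ler_expR oppr_ge0 mulr_le0_ge0 ?powR_ge0//.
all: by rewrite mulr_ge0_le0 ?subr_ge0 ?(ltW s1) ?(ltW a0).
Qed.

Lemma limit_mass_surj (R : realType) (s theta : R) : 0 <= s -> s < 1 ->
  0 < theta -> theta < 1 -> exists2 a, 0 < a & limit_mass s a = theta.
Proof.
move=> s0 s1 t0 t1.
have os0 : 0 < 1 - s by rewrite subr_gt0.
(* Chosen so that 1 - exp(-(1-s)K) = theta; [limit_mass_lb] then places the value at [K] above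
   [theta]. *)
pose K := - ln (1 - theta) / (1 - s).
have K0 : 0 <= K.
  by rewrite divr_ge0 ?(ltW os0)// oppr_ge0 ln_le0//; lra.
have hK : theta <= limit_mass s K.
  apply: le_trans (limit_mass_lb s0 s1 K0).
  rewrite /K mulrC divfK ?gt_eqF// opprK lnK ?posrE; lra.
(* Clamping at 0 gives a function continuous on the whole line, as the estimates on [limit_mass]
   require nonnegative arguments. *)
pose h a := limit_mass s (Num.max a 0).
have hmax0 (x : R) : 0 <= Num.max x 0 by rewrite le_max lexx orbT.
have ch : continuous (h : R -> R).
  move=> x; apply/cvgrPdist_lt => e e0.
  have [d d0 hd] := limit_mass_small s0 s1 e0.
  (* By subadditivity the increment is at most the mass at the clamped difference, hence at most the
     mass at [d]. *)
  have key (a b : R) : a <= b -> b - a < d -> h b - h a < e /\ 0 <= h b - h a.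
    move=> ab bad; have mab : Num.max a 0 <= Num.max b 0 by rewrite ge_max hmax0 le_max ab.
    split; last by rewrite subr_ge0 limit_mass_le.
    have ba : Num.max b 0 - Num.max a 0 <= b - a.
      rewrite lerBlDr ge_max -lerBlDl opprB addrC subrK le_max lexx/=.
      by rewrite addr_ge0// subr_ge0.
    have -> : h b = limit_mass s (Num.max a 0 + (Num.max b 0 - Num.max a 0)).
      by rewrite /h; congr limit_mass; ring.
    have H1 : 0 <= Num.max b 0 - Num.max a 0 by rewrite subr_ge0.
    have H2 := limit_mass_subadd s1 (hmax0 a) H1.
    have H3 := limit_mass_le s1 H1 (le_trans ba (ltW bad)).
    rewrite /h ltrBlDl; apply: le_lt_trans H2 _; rewrite ltrD2l.
    exact: le_lt_trans H3 hd.
  near=> y.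
  have xyd : `|x - y| < d by near: y; exists d.
  have [xy|yx] := leP x y.
    have [] := key _ _ xy; first by move: xyd; rewrite distrC ger0_norm// subr_ge0.
    by move=> ? ?; rewrite distrC ger0_norm.
  have [] := key _ _ (ltW yx); first by move: xyd; rewrite ger0_norm// subr_ge0 ltW.
  by move=> ? ?; rewrite ger0_norm.
have h0 : h 0 = 0.
  rewrite /h maxxx /limit_mass mulr0 /kernel_integral.
  under eq_integral do rewrite /quorum_kernel mul0r oppr0 expR0 subrr mulr0.
  by rewrite integral0 mulr0.
have hKE : h K = limit_mass s K by rewrite /h max_l.
have [|c] := IVT K0 (continuous_subspaceT ch) (v := theta).
  by rewrite h0 hKE ge_min (ltW t0) le_max hK orbT.
rewrite in_itv/= => /andP[c0 _] hc.
exists c; last by rewrite -hc /h max_l.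
by rewrite lt_neqAle c0 andbT; apply/eqP => e; move: hc t0; rewrite -e h0 => ->; rewrite ltxx.
Unshelve. all: by end_near. Qed.

(** * The mean discovered mass *)

(* Expected discovered mass at time [a * N / lambda]. *)
Definition mean_mass (R : realType) (s a : R) (N : nat) : R :=
  \sum_(i < N) zipf s i * (1 - expR (- (a * (N%:R * zipf s i)))).

Section mean_mass_bounds.
Context {R : realType} (s : R).
Hypotheses (s0 : 0 <= s) (s1 : s < 1).
Variable n : nat.

Let os0 : 0 < 1 - s. Proof. by rewrite subr_gt0. Qed.
Let e : R := n.+1%:R^-1.
Let e0 : 0 < e. Proof. by rewrite invr_gt0. Qed.
Let ne : n.+1%:R * e = 1. Proof. by rewrite mulfV. Qed.
(** With N = n + 1 and mesh 1/N, this Riemann sum of x^(-s) is the inverse of N^(1-s) / sum_j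
    j^(-s), so N w_i = (i/N)^(-s) / Y for 1-based i. *)
Let Y : R := \sum_(i < n.+1) (i.+1%:R * e) `^ (- s) * e.
Let yy (i : nat) : R := (i.+1%:R * e) `^ (- s).

Let y0 i : 0 < yy i. Proof. by rewrite powR_gt0// mulr_gt0. Qed.

Let Y0 : 0 < Y.
Proof.
rewrite /Y big_ord_recl ltr_pwDl// ?mulr_gt0 ?y0// sumr_ge0// => i _.
by rewrite mulr_ge0 ?powR_ge0// ltW.
Qed.

Let zipfE (i : 'I_n.+1) : zipf s i = yy i * e / Y.
Proof.
have H j : j.+1%:R `^ (- s) = n.+1%:R `^ (- s) * yy j :> R.
  by rewrite /yy -powRM// ?mulr_ge0 ?(ltW e0)// mulrCA ne mulr1.
rewrite /zipf; under eq_bigr do rewrite H.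
rewrite -mulr_sumr H -mulf_div mulfV ?mul1r ?gt_eqF ?powR_gt0//.
by rewrite /Y -mulr_suml invfM mulrACA mulfV ?gt_eqF// mulr1.
Qed.

Let Y_ub : Y <= (1 - s)^-1.
Proof.
have := @antitone_sum_le_integral R (fun x => x `^ (- s)) e e0 (measurable_powR _)
  (fun x => powR_ge0 _ _) (fun x y x0 xy => powRN_le s0 x0 xy) n.+1.
by rewrite ne integral_powRN// powR1 div1r lee_fin.
Qed.

(** The cell ]0, e] is paid for by the integral of x^(-s). On ]e, 1] the left-endpoint comparison
    uses the first n samples, and the last one is nonnegative. *)
Let sum_lb (f : R -> R) : measurable_fun setT f -> (forall x, 0 <= f x) ->
  (forall x y, 0 < x -> x <= y -> f y <= f x) -> (forall x, f x <= x `^ (- s)) ->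
  (\int[lebesgue_measure]_(x in `]0%R, 1%R]) (f x)%:E <=
    (e `^ (1 - s) / (1 - s) + \sum_(i < n.+1) f (i.+1%:R * e) * e)%:E)%E.
Proof.
move=> mf f0 anti fle.
rewrite (@integral_itv_splitoc _ 0 e 1)// ?(ltW e0)//; last first.
  by rewrite /e invf_le1// ler1n.
rewrite EFinD leeD//.
  rewrite -integral_powRN//; apply: ge0_le_integral => //.
  - by move=> x _; rewrite lee_fin.
  - exact/measurable_EFinP/measurable_funTS.
  - by apply/measurable_EFinP/measurable_funTS; exact: measurable_powR.
  - by move=> x _; rewrite lee_fin.
have := integral_le_antitone_sum e0 mf f0 anti n; rewrite ne => /le_trans; apply.
by rewrite lee_fin big_ord_recr/= lerDl mulr_ge0// ltW.
Qed.

Let Y_lb : (1 - s)^-1 <= e `^ (1 - s) / (1 - s) + Y.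
Proof.
have := @sum_lb (fun x => x `^ (- s)) (measurable_powR _)
  (fun x => powR_ge0 _ _) (fun x y x0 xy => powRN_le s0 x0 xy) (fun=> lexx _).
by rewrite integral_powRN// powR1 div1r lee_fin.
Qed.

Let mean_massE a : mean_mass s a n.+1 =
  Y^-1 * \sum_(i < n.+1) quorum_kernel s (a * Y^-1) (i.+1%:R * e) * e.
Proof.
rewrite mulr_sumr; apply: eq_bigr => i _; rewrite zipfE /quorum_kernel -/(yy i).
have -> : n.+1%:R * (yy i * e / Y) = yy i / Y by rewrite -mulrA mulrCA (mulrA _ e) ne mul1r.
rewrite (_ : a * (yy i / Y) = a / Y * yy i); first by ring.
by rewrite mulrCA mulrC.
Qed.

(** Since 1/Y >= 1 - s, both the prefactor and the kernel parameter can be lowered to their limiting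
    values. The error is the first cell's contribution e^(1-s). *)
Lemma mean_mass_lb a : 0 <= a ->
  limit_mass s a - n.+1%:R `^ (- (1 - s)) <= mean_mass s a n.+1.
Proof.
move=> a0.
have Y1 : 1 - s <= Y^-1 by rewrite -[leLHS]invrK lef_pV2 ?posrE ?invr_gt0.
have a1 : 0 <= (1 - s) * a by rewrite mulr_ge0// ltW.
have := @sum_lb (quorum_kernel s ((1 - s) * a)) (measurable_quorum_kernel _ _)
  (fun x => quorum_kernel_ge0 _ _ a1)
  (fun x y x0 xy => quorum_kernel_antitone s0 a1 x0 xy).
rewrite -/(kernel_integral _ _) -(fineK (kernel_integral_fin s1 a1)) lee_fin => H.
rewrite lerBlDl.
have -> : n.+1%:R `^ (- (1 - s)) = e `^ (1 - s).
  by rewrite /e -powR_inv1// -powRrM mulN1r.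
apply: (@le_trans _ _ (e `^ (1 - s) + (1 - s) *
    \sum_(i < n.+1) quorum_kernel s ((1 - s) * a) (i.+1%:R * e) * e)).
  rewrite /limit_mass -(ler_pdivlMl _ _ os0) mulrDr mulKf ?gt_eqF// (mulrC _ (e `^ _)).
  by apply: H => x; rewrite ler_piMr ?powR_ge0// onem_expRN_le1.
rewrite mean_massE lerD2l; apply: ler_pM => //; first exact: ltW.
  by apply: sumr_ge0 => i _; rewrite mulr_ge0 ?quorum_kernel_ge0// ltW.
apply: ler_sum => i _; rewrite ler_wpM2r ?(ltW e0)// ler_wpM2l ?powR_ge0//.
by apply: onem_expRN_le; rewrite ler_wpM2r ?powR_ge0// mulrC ler_wpM2l.
Qed.

(** With 1/Y = (1-s)k, one factor k comes from the prefactor and a second one from rescaling the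
    parameter by concavity. The lower bound on Y controls k. *)
Lemma mean_mass_ub a : (0 < n)%N -> 0 <= a ->
  mean_mass s a n.+1 <= (1 - n.+1%:R `^ (- (1 - s))) ^- 2 * limit_mass s a.
Proof.
move=> n0 a0.
have -> : n.+1%:R `^ (- (1 - s)) = e `^ (1 - s).
  by rewrite /e -powR_inv1// -powRrM mulN1r.
pose k := Y^-1 / (1 - s).
have k1 : 1 <= k.
  by rewrite /k ler_pdivlMr// mul1r -[leLHS]invrK lef_pV2 ?posrE ?invr_gt0.
have k0 : 0 <= k by rewrite (le_trans _ k1).
have YE : Y^-1 = (1 - s) * k by rewrite mulrC divfK// gt_eqF.
(* Here n > 0 matters: it makes the mesh strictly smaller than 1. *)
have e1 : 0 < 1 - e `^ (1 - s).
  have := @gt0_ltr_powR _ _ os0 e 1; rewrite powR1 subr_gt0; apply.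
  - by rewrite nnegrE ltW.
  - by rewrite nnegrE.
  - by rewrite /e invf_lt1// ltr1n.
have kub : k <= (1 - e `^ (1 - s))^-1.
  rewrite /k -invfM lef_pV2 ?posrE// ?mulr_gt0//.
  have := Y_lb; rewrite -(ler_pM2r os0) mulrDl mulVf ?gt_eqF// divfK ?gt_eqF//; lra.
have aY : 0 <= a / Y by rewrite divr_ge0// ltW.
have H := @antitone_sum_le_integral R (quorum_kernel s (a / Y)) e e0
  (measurable_quorum_kernel _ _) (fun x => quorum_kernel_ge0 _ _ aY)
  (fun x y x0 xy => quorum_kernel_antitone s0 aY x0 xy) n.+1.
have L : 0 <= limit_mass s a.
  by rewrite /limit_mass mulr_ge0 ?(ltW os0)// fine_ge0// kernel_integral_ge0// mulr_ge0// ltW.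
apply: (@le_trans _ _ (k * limit_mass s (k * a))).
  rewrite mean_massE /limit_mass mulrCA (mulrA (1 - s)) -YE (mulrA (1 - s)) -YE.
  rewrite ler_wpM2l ?invr_ge0 ?(ltW Y0)// (mulrC Y^-1).
  rewrite -lee_fin fineK ?kernel_integral_fin//.
  by move: H; rewrite ne.
apply: (@le_trans _ _ (k * (k * limit_mass s a))).
  by rewrite ler_wpM2l// limit_mass_scale.
rewrite mulrA ler_wpM2r// -expr2 -exprVn.
by rewrite lerXn2r ?nnegrE// invr_ge0 ltW.
Qed.

End mean_mass_bounds.

Lemma mean_mass_cvg (R : realType) (s a : R) : 0 <= s -> s < 1 -> 0 <= a ->
  mean_mass s a N @[N --> \oo] --> limit_mass s a.
Proof.
move=> s0 s1 a0; rewrite -cvg_shiftS.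
have os0 : 0 < 1 - s by rewrite subr_gt0.
have P0 := @powRN_cvg0 R (1 - s) os0.
apply: (@squeeze_cvgr _ _ _ _ (fun n => limit_mass s a - n.+1%:R `^ (- (1 - s)))
  (fun n => (1 - n.+1%:R `^ (- (1 - s))) ^- 2 * limit_mass s a)).
- near=> n; rewrite mean_mass_lb//= mean_mass_ub//.
  by near: n; exists 1%N.
- rewrite -[X in _ --> X]subr0; apply: cvgB; first exact: cvg_cst.
  by have := P0; rewrite -cvg_shiftS.
- rewrite [X in _ --> X](_ : _ = (1 - 0) ^- 2 * limit_mass s a); last first.
    by rewrite subr0 expr1n invr1 mul1r.
  apply: cvgM; last exact: cvg_cst.
  apply: cvgV; first by rewrite subr0 expr1n oner_eq0.
  apply: (@continuous_cvg _ _ _ _ _ _ (fun x : R => x ^+ 2)); first exact: exprn_continuous.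
  apply: cvgB; first exact: cvg_cst.
  by have := P0; rewrite -cvg_shiftS.
Unshelve. all: by end_near. Qed.

(** * Normalization and sum of squares of the Zipf weights *)

Section zipf_theory.
Context {R : realType} (s : R).
Hypotheses (s0 : 0 <= s).

Let H_ge (N : nat) : (0 < N)%N ->
  N%:R `^ (1 - s) <= \sum_(j < N) j.+1%:R `^ (- s) :> R.
Proof.
move=> N0; have NR : 0 < N%:R :> R by rewrite ltr0n.
apply: (@le_trans _ _ (\sum_(j < N) N%:R `^ (- s))).
  rewrite sumr_const card_ord -[leRHS]mulr_natl powRD; last by rewrite (gt_eqF NR) implybT.
  by rewrite powRr1// ltW.
by apply: ler_sum => j _; rewrite powRN_le// ler_nat.
Qed.

Let H_gt0 (N : nat) : (0 < N)%N -> 0 < \sum_(j < N) j.+1%:R `^ (- s) :> R.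
Proof. by move=> N0; rewrite (lt_le_trans _ (H_ge N0))// powR_gt0// ltr0n. Qed.

Lemma zipf_gt0 (N : nat) (i : 'I_N) : 0 < zipf s i.
Proof.
have N0 : (0 < N)%N by exact: leq_ltn_trans (ltn_ord i).
by rewrite divr_gt0 ?H_gt0// powR_gt0.
Qed.

Lemma zipf_sum (N : nat) : (0 < N)%N -> \sum_(i < N) zipf s i = 1.
Proof. by move=> N0; rewrite -mulr_suml mulfV// gt_eqF ?H_gt0. Qed.

(** The weights sum to 1, so the sum of squares is at most the largest weight, 1 / sum_j j^(-s).
    Each of the N terms of that sum is at least N^(-s). *)
Lemma zipf_sum_sqr (N : nat) : (0 < N)%N ->
  \sum_(i < N) zipf s i ^+ 2 <= N%:R `^ (- (1 - s)).
Proof.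
move=> N0; have H0 := H_gt0 N0.
rewrite powRN; apply: (@le_trans _ _ (\sum_(j < N) j.+1%:R `^ (- s))^-1); last first.
  by rewrite lef_pV2 ?posrE// ?H_ge// powR_gt0// ltr0n.
set H := \sum_(j < N) _ in H0 *.
rewrite -[leRHS]mul1r -(zipf_sum N0) mulr_suml; apply: ler_sum => i _.
rewrite expr2 ler_wpM2l ?(ltW (zipf_gt0 i))// /zipf -[leRHS]mul1r.
rewrite ler_wpM2r ?invr_ge0 ?(ltW H0)//.
by have := @powRN_le R s 1 i.+1%:R s0 ltr01; rewrite powR1 ler1n; apply.
Qed.

End zipf_theory.

(** * Concentration and the quorum time *)

Section indicator_combinations.
Context {d : measure_display} {Omega : measurableType d} {R : realType}.
Variable P : probability Omega R.
Local Open Scope ereal_scope.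

Lemma integrable_indic_sum (K : finType) (c : K -> R) (B : K -> set Omega) :
  (forall k, measurable (B k)) ->
  P.-integrable setT (fun x => (\sum_(k : K) c k * \1_(B k) x)%R%:E).
Proof.
move=> mB; have -> : (fun x => (\sum_(k : K) c k * \1_(B k) x)%R%:E) =
    (fun x => \sum_(k : K) (c k)%:E * (\1_(B k) x)%:E).
  by apply/funext => x; rewrite -sumEFin; under eq_bigr do rewrite EFinM.
apply: integrable_sum => // k _; apply: integrableZl => //.
exact: integrable_indic.
Qed.

Lemma integral_indic_sum (K : finType) (c : K -> R) (B : K -> set Omega) :
  (forall k, measurable (B k)) ->
  \int[P]_x (\sum_(k : K) c k * \1_(B k) x)%R%:E =
  (\sum_(k : K) c k * fine (P (B k)))%R%:E.
Proof.
move=> mB.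
under eq_integral => x _ do rewrite -sumEFin.
rewrite integral_sum//; last first.
  move=> k; under eq_fun do rewrite EFinM.
  by apply: integrableZl => //; exact: integrable_indic.
rewrite -sumEFin; apply: eq_bigr => k _.
under eq_integral do rewrite EFinM.
rewrite integralZl//; last exact: integrable_indic.
by rewrite integral_indic// setIT EFinM fineK// fin_num_measure.
Qed.

(** A variance bound: pairwise independence cancels the off-diagonal covariances, and a diagonal
    term is w_i^2 (q - q^2) with q a probability. *)
Lemma expectation_sqr_indic_sum (n : nat) (w : 'I_n -> R) (A : 'I_n -> set Omega) :
  (forall i, measurable (A i)) ->
  (forall i j, i != j -> P (A i `&` A j) = P (A i) * P (A j)) ->
  \int[P]_x ((\sum_(i < n) w i * \1_(A i) x - \sum_(i < n) w i * fine (P (A i))) ^+ 2)%R%:E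
  <= (\sum_(i < n) w i ^+ 2)%R%:E.
Proof.
move=> mA ind; set m := (\sum_(i < n) w i * fine (P (A i)))%R.
pose X x := (\sum_(i < n) w i * \1_(A i) x)%R.
(* The square is again a combination of indicators, indexed by pairs, so the same integration
   formula applies. *)
pose X2 x := (\sum_(p : 'I_n * 'I_n) (w p.1 * w p.2) * \1_(A p.1 `&` A p.2) x)%R.
have X2E x : (X x ^+ 2)%R = X2 x.
  rewrite expr2 /X /X2 big_distrlr/= pair_bigA/=; apply: eq_bigr => p _.
  by rewrite indicI/=; ring.
have mAA (p : 'I_n * 'I_n) : measurable (A p.1 `&` A p.2) by exact: measurableI.
have iX : P.-integrable setT (fun x => (X x)%:E) by exact: integrable_indic_sum.
have iX2 : P.-integrable setT (fun x => (X2 x)%:E).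
  exact: (@integrable_indic_sum _ (fun p => w p.1 * w p.2)%R (fun p => A p.1 `&` A p.2)).
have -> : \int[P]_x ((X x - m) ^+ 2)%:E =
    \int[P]_x ((X2 x)%:E + ((- (m *+ 2))%:E * (X x)%:E + (m ^+ 2)%:E)).
  apply: eq_integral => x _; rewrite -EFinM -!EFinD; congr (_%:E).
  by rewrite -X2E; ring.
have iZ : P.-integrable setT (fun x => (- (m *+ 2))%:E * (X x)%:E) by exact: integrableZl.
have iC : P.-integrable setT (fun x => (m ^+ 2)%:E).
  exact: (finite_measure_integrable_cst P (m ^+ 2)).
rewrite integralD//; last exact: integrableD.
rewrite integralD// integralZl// integral_cst//= probability_setT mule1.
rewrite (integral_indic_sum _ mA) -/m.
rewrite (@integral_indic_sum _ (fun p => w p.1 * w p.2)%R (fun p => A p.1 `&` A p.2))//.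
rewrite -EFinM -!EFinD lee_fin.
(* Expanding -m^2 over the same pairs allows termwise subtraction. *)
have -> : (- (m *+ 2) * m + m ^+ 2 = - \sum_(p : 'I_n * 'I_n)
    (w p.1 * w p.2) * (fine (P (A p.1)) * fine (P (A p.2))))%R.
  have -> : (- (m *+ 2) * m + m ^+ 2 = - (m * m))%R by ring.
  congr (- _)%R; rewrite /m big_distrlr/= pair_bigA/=; apply: eq_bigr => p _; ring.
rewrite -sumrB -(pair_bigA _ (fun i j => (w i * w j * fine (P (A i `&` A j)) -
  w i * w j * (fine (P (A i)) * fine (P (A j))))%R))/=.
apply: ler_sum => i _; rewrite (bigD1 i)//= big1; last first.
  by move=> j ji; rewrite ind 1?eq_sym// fineM ?fin_num_measure// subrr.
rewrite addr0 setIid -mulrBr -expr2 ler_piMr ?sqr_ge0//.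
have q0 : (0 <= fine (P (A i)))%R by rewrite fine_ge0.
have q1 : (fine (P (A i)) <= 1)%R.
  by rewrite -lee_fin fineK ?fin_num_measure// probability_le1.
by have := mulr_ge0 q0 q0; lra.
Qed.

(** Chebyshev's inequality for any event [B] contained in the deviation event, so that one-sided
    events can be used directly; integrate eta^2 1_B against the squared deviation. *)
Lemma indic_sum_chebyshev (n : nat) (w : 'I_n -> R) (A : 'I_n -> set Omega) (eta : R)
    (B : set Omega) :
  (forall i, measurable (A i)) ->
  (forall i j, i != j -> P (A i `&` A j) = P (A i) * P (A j)) ->
  (0 < eta)%R -> measurable B ->
  (forall x, B x -> (eta <= `|\sum_(i < n) w i * \1_(A i) x
                             - \sum_(i < n) w i * fine (P (A i))|)%R) ->
  P B <= ((\sum_(i < n) w i ^+ 2) / eta ^+ 2)%R%:E.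
Proof.
move=> mA ind eta0 mB hB.
have e20 : (0 < eta ^+ 2)%R by rewrite exprn_gt0.
rewrite EFinM muleC -lee_pdivrMl ?invr_gt0// invrK.
apply: le_trans (expectation_sqr_indic_sum w mA ind).
rewrite -[P B]mul1e -(setIT B) -integral_indic//.
have mB1 : measurable_fun setT (fun x => (\1_B x : R)%:E).
  by apply/measurable_EFinP; exact: measurable_indic.
rewrite mul1e -ge0_integralZl_EFin ?(ltW e20)//.
apply: ge0_le_integral => //.
- by move=> x _; rewrite mule_ge0// lee_fin ?ltW.
- exact: emeasurable_funM.
- apply/measurable_EFinP; apply: measurable_funX; apply: measurable_funB => //.
  by apply: measurable_sum => i; exact: measurable_funM.
move=> x _; rewrite -EFinM lee_fin indicE.
have [xB|xB] := boolP (x \in B); last by rewrite mulr0 sqr_ge0.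
rewrite mulr1 -[leRHS]real_normK ?num_real// lerXn2r ?nnegrE ?(ltW eta0)//.
by apply: hB; rewrite inE in xB.
Qed.

End indicator_combinations.

(** Apply the product rule to the family equal to [B] at [i] and [j] and to the whole line
    elsewhere, where the factors are 1. *)
Lemma mutually_independent_pair (I : finType) (R : realType) (d : measure_display)
  (Omega : measurableType d) (P : probability Omega R) (X : I -> {RV P >-> R})
  (B : set R) (i j : I) :
  mutually_independent X -> measurable B -> i != j ->
  (P (X i @^-1` B `&` X j @^-1` B) = P (X i @^-1` B) * P (X j @^-1` B))%E.
Proof.
move=> ind mB ij.
pose C k : set R := if (k == i) || (k == j) then B else setT.
have mC k : measurable (C k) by rewrite /C; case: ifP.
have := ind C mC.
have -> : [set omega | forall k, C k (X k omega)] = X i @^-1` B `&` X j @^-1` B.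
  apply/seteqP; split=> w /=.
    move=> h; split.
      by have := h i; rewrite /C eqxx.
    by have := h j; rewrite /C eqxx orbT.
  by move=> [Bi Bj] k; rewrite /C; case: eqVneq => [->//|ki]; case: eqVneq => [->|].
move=> ->; rewrite (bigD1 i)//= (bigD1 j) 1?eq_sym//= {1 2}/C !eqxx orbT.
rewrite big1 ?mule1// => k /andP[ki kj].
by rewrite /C (negbTE ki) (negbTE kj) preimage_setT probability_setT.
Qed.

Lemma exponential_cdf (R : realType) (d : measure_display)
  (Omega : measurableType d) (P : probability Omega R) (X : {RV P >-> R}) (rate t : R) :
  0 <= rate -> 0 < t -> exponentially_distributed X rate ->
  P (X @^-1` `]-oo, t]%classic) = (1 - expR (- (rate * t)))%:E.
Proof.
move=> r0 t0 /(_ `]-oo, t]%classic (measurable_itv _)) h.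
rewrite -[LHS]/(distribution P X `]-oo, t]%classic) h /exponential_prob.
have -> : `]-oo, t]%classic = `]-oo, 0[%classic `|` `[0, t]%classic :> set R.
  apply/seteqP; split=> x /=; rewrite !in_itv/=.
    by move=> xt; case: (ltP x 0) => x0; [left|right; rewrite xt].
  by move=> [x0|/andP[]//]; rewrite ltW// (lt_trans x0).
rewrite ge0_integral_setU//; last 3 first.
- apply/measurable_EFinP/measurable_funTS; exact: measurable_exponential_pdf.
- by move=> x _; rewrite lee_fin exponential_pdf_ge0.
- apply/disj_setPS => x /= []; rewrite !in_itv/= => x0 /andP[x0' _].
  by move: (lt_le_trans x0 x0'); rewrite ltxx.
rewrite integral0_eq ?add0e; last first.
  by move=> x /=; rewrite in_itv/= => x0; rewrite lt0_exponential_pdf.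
by rewrite -/(exponential_prob rate _) exponential_prob_itv0c// mulNr EFinB.
Qed.

(** * The quorum time as a hitting time, and its measurability *)

Section quorum_time_theory.
Context {R : realType} {N : nat} {Omega : Type}.
Variables (w : 'I_N -> R) (T : 'I_N -> Omega -> R) (theta : R).
Hypotheses (w0 : forall i, 0 <= w i).

Lemma discovered_mass_le omega t u : t <= u ->
  discovered_mass w T t omega <= discovered_mass w T u omega.
Proof.
move=> tu; apply: ler_sum => i _; rewrite ler_wpM2l// !indicE ler_nat.
case: (boolP (omega \in [set x | T i x <= t])) => //.
rewrite inE/= => Tt; rewrite mem_set//=; exact: le_trans tu.
Qed.

Let hits omega := [set t : R | 0 <= t /\ theta < discovered_mass w T t omega].

Lemma quorum_time_le omega t : 0 <= t -> theta < discovered_mass w T t omega ->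
  quorum_time w T theta omega <= t.
Proof. by move=> t0 ht; apply: ge_inf; [exists 0 => u []|split]. Qed.

(** The weight condition makes the set of hitting times nonempty; otherwise [inf] would take its
    default value 0 and the forward direction could fail. *)
Lemma quorum_time_ltP omega t : theta < \sum_(i < N) w i ->
  quorum_time w T theta omega < t <->
  exists2 u, 0 <= u < t & theta < discovered_mass w T u omega.
Proof.
move=> w1; split=> [|[u /andP[u0 ut] hu]]; last exact: le_lt_trans (quorum_time_le u0 hu) ut.
have ne : hits omega !=set0.
  (* A nonnegative time dominating every [T i omega], at which the whole weight has been
     discovered. *)
  exists (\sum_(i < N) `|T i omega|); split; first exact: sumr_ge0.
  apply: (lt_le_trans w1); apply: ler_sum => i _.
  rewrite indicE mem_set ?mulr1//= (bigD1 i)//=.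
  by rewrite (le_trans (ler_norm _))// lerDl sumr_ge0.
by move=> /(inf_lt ne)[u [u0 hu] ut]; exists u; rewrite ?u0.
Qed.

End quorum_time_theory.

Lemma measurable_discovered_mass (R : realType) (N : nat) (d : measure_display)
  (Omega : measurableType d) (w : 'I_N -> R) (T : 'I_N -> Omega -> R) (t : R) :
  (forall i, measurable_fun setT (T i)) ->
  measurable_fun setT (discovered_mass w T t).
Proof.
move=> mT; apply: measurable_sum => i; apply: measurable_funM => //.
apply: measurable_indic; have := mT i measurableT _ (measurable_itv `]-oo, t]).
by rewrite setTI; congr (measurable _); apply/seteqP; split=> x /=; rewrite in_itv.
Qed.

(* By monotonicity of the discovered mass in t, [quorum_time < t] is a countable
   union over rational times. *)
Lemma measurable_quorum_time (R : realType) (N : nat) (d : measure_display)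
  (Omega : measurableType d) (w : 'I_N -> R) (T : 'I_N -> Omega -> R) (theta : R) :
  (forall i, 0 <= w i) -> theta < \sum_(i < N) w i ->
  (forall i, measurable_fun setT (T i)) ->
  measurable_fun setT (quorum_time w T theta).
Proof.
move=> w0 w1 mT.
apply: (measurability _ (RGenInftyO.measurableE R)) => // _ [_ [t ->] <-].
rewrite setTI.
have -> : quorum_time w T theta @^-1` `]-oo, t[%classic =
    \bigcup_(q in [set q : rat | 0 <= (ratr q : R) < t])
      [set omega | theta < discovered_mass w T (ratr q) omega].
  apply/seteqP; split=> omega /=; rewrite in_itv/=.
    move=> /(quorum_time_ltP _ _ _ w1)[u /andP[u0 ut] hu].
    have [q] := rat_in_itvoo ut; rewrite in_itv/= => /andP[uq qt].
    exists q => /=; first by rewrite qt andbT (le_trans u0)// ltW.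
    by apply: (lt_le_trans hu); apply: discovered_mass_le => //; exact: ltW.
  move=> [q /= qt hq]; apply/(quorum_time_ltP _ _ _ w1).
  by exists (ratr q).
rewrite bigcup_mkcond; apply: bigcupT_measurable_rat => q; case: ifP => // _.
have := measurable_discovered_mass w (ratr q) mT measurableT (measurable_itv `]theta, +oo[).
by rewrite setTI; congr (measurable _); apply/seteqP; split=> x /=; rewrite in_itv/= andbT.
Qed.

(** At time a N / lambda the rate [lambda] cancels, so the expected mass is exactly
    [mean_mass s a N]; Chebyshev and the square-sum bound then apply. *)
Lemma discovered_mass_concentration (R : realType) (lambda s a eta : R) (N : nat)
  (d : measure_display) (Omega : measurableType d) (P : probability Omega R)
  (T : 'I_N -> {RV P >-> R}) (B : set Omega) :
  0 < lambda -> 0 <= s -> 0 < a -> 0 < eta -> (0 < N)%N ->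
  mutually_independent T ->
  (forall i, exponentially_distributed (T i) (lambda * zipf s i)) ->
  measurable B ->
  (forall omega, B omega ->
    eta <= `|discovered_mass (zipf s (N := N)) T (a * N%:R / lambda) omega
             - mean_mass s a N|) ->
  (P B <= (N%:R `^ (- (1 - s)) / eta ^+ 2)%:E)%E.
Proof.
move=> l0 s0 a0 eta0 N0 Tind Texp mB hB; set t := a * N%:R / lambda in hB.
have t0 : 0 < t by rewrite divr_gt0// mulr_gt0// ltr0n.
pose A i := T i @^-1` `]-oo, t]%classic.
have AE i : [set x | T i x <= t] = A i.
  by apply/seteqP; split=> x; rewrite /A/= in_itv.
have mA i : measurable (A i) by rewrite -[A i]setTI; exact: measurable_funPT.
have mE : mean_mass s a N = \sum_(i < N) zipf s i * fine (P (A i)).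
  apply: eq_bigr => i _; rewrite (exponential_cdf _ t0 (Texp i)) /=; last first.
    by rewrite mulr_ge0 ?(ltW l0)// ltW// zipf_gt0.
  congr (_ * (1 - expR (- _))); rewrite /t; field; exact: lt0r_neq0.
have H := @indic_sum_chebyshev _ _ _ P N (zipf s (N := N)) A eta B mA.
apply: le_trans (H _ eta0 mB _) _.
- by move=> i j ij; exact: mutually_independent_pair.
- move=> x Bx; rewrite -mE; apply: le_trans (hB x Bx) _.
  by rewrite /discovered_mass; under eq_bigr do rewrite AE.
- by rewrite lee_fin ler_wpM2r ?invr_ge0 ?sqr_ge0// zipf_sum_sqr.
Qed.

(** * Uniqueness of the limit constant and convergence in probability *)

Theorem theorem5p3 (R : realType) (lambda s theta : R)
    (lambda_gt0 : 0 < lambda) (s_ge0 : 0 <= s) (s_lt1 : s < 1)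
    (theta_gt0 : 0 < theta) (theta_lt1 : theta < 1)
    (d : nat -> measure_display) (Omega : forall N : nat, measurableType (d N))
    (P : forall N : nat, probability (Omega N) R)
    (T : forall N : nat, 'I_N -> {RV (P N) >-> R})
    (T_indep : forall N : nat, mutually_independent (T N))
    (T_exp : forall (N : nat) (i : 'I_N),
      exponentially_distributed (T N i) (lambda * zipf s i)) :
  exists alpha : R,
    unique (quorum_equation s theta) alpha /\
    cvg_in_probability P
      (fun N omega => quorum_time (zipf s (N := N)) (T N) theta omega / N%:R)
      (alpha / lambda).
Proof.
have midl (x y : R) : x < y -> x + (y - x) / 2 < y by lra.
have midr (x y : R) : x < y -> x < y - (y - x) / 2 by lra.
have [alpha alpha0 halpha] := limit_mass_surj s_ge0 s_lt1 theta_gt0 theta_lt1.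
exists alpha; split.
  split; first by apply/(quorum_equationE _ s_lt1 (ltW alpha0)).
  move=> b hb; have b0 := quorum_equation_ge0 s_lt1 theta_gt0 hb.
  move/(quorum_equationE _ s_lt1 b0) : hb => hb.
  apply/eqP; rewrite eq_le !leNgt; apply/andP; split; apply/negP => lt.
    by have := limit_mass_lt s_ge0 s_lt1 b0 lt; rewrite hb halpha ltxx.
  by have := limit_mass_lt s_ge0 s_lt1 (ltW alpha0) lt; rewrite hb halpha ltxx.
have w0 N (i : 'I_N) : 0 <= zipf s i by rewrite ltW// zipf_gt0.
have w1 N : (0 < N)%N -> theta < \sum_(i < N) zipf s i by move=> N0; rewrite zipf_sum.
have mX N : measurable_fun setT
    (fun omega => quorum_time (zipf s (N := N)) (T N) theta omega / N%:R).
  (* For N = 0 the quotient is 0 by the convention on division, hence constant. *)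
  have [->|N0] := posnP N.
    by under eq_fun do rewrite invr0 mulr0; exact: measurable_cst.
  by apply: measurable_funM => //; exact: measurable_quorum_time (w1 _ N0) _.
split=> // eps eps0.
have le0 : 0 < lambda * eps by rewrite mulr_gt0.
pose ap := alpha + lambda * eps.
(* The maximum keeps the early time positive even when lambda eps >= alpha, while [am] stays below
   [alpha]. *)
pose am := Num.max (alpha - lambda * eps) (alpha / 2).
have ap0 : 0 < ap by rewrite addr_gt0.
have am0 : 0 < am by rewrite lt_max divr_gt0// orbT.
have hp : theta < limit_mass s ap by rewrite -halpha limit_mass_lt ?ltrDl// ltW.
have hm : limit_mass s am < theta.
  by rewrite -halpha limit_mass_lt ?(ltW am0)// gt_max ltrBlDr ltrDl le0/= ltr_pdivrMr// ltr_pMr// ltr1n.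
(* Half of each gap is given up to the convergence of the means; the other half is the deviation
   left for Chebyshev. *)
pose ep := (limit_mass s ap - theta) / 2.
pose em := (theta - limit_mass s am) / 2.
have ep0 : 0 < ep by rewrite divr_gt0// subr_gt0.
have em0 : 0 < em by rewrite divr_gt0// subr_gt0.
have Lp : \forall N \near \oo, theta + ep <= mean_mass s ap N.
  apply: (cvgr_ge _ (mean_mass_cvg s_ge0 s_lt1 (ltW ap0))).
  exact: midl.
have Lm : \forall N \near \oo, mean_mass s am N <= theta - em.
  apply: (cvgr_le _ (mean_mass_cvg s_ge0 s_lt1 (ltW am0))).
  exact: midr.
pose C := (ep ^- 2 + em ^- 2 : R).
have bound : \forall N \near \oo,
    (0 <= P N [set omega | (eps < `|quorum_time (zipf s (N := N)) (T N) theta omega / N%:R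
       - alpha / lambda|)%R] <= (N%:R `^ (- (1 - s)) * C)%:E)%E.
  near=> N; rewrite measure_ge0/=.
  have N0 : (0 < N)%N by near: N; exists 1%N.
  have NR : 0 < N%:R :> R by rewrite ltr0n.
  have hmp : theta + ep <= mean_mass s ap N by near: N.
  have hmm : mean_mass s am N <= theta - em by near: N.
  pose M a := discovered_mass (zipf s (N := N)) (T N) (a * N%:R / lambda).
  (* The bad events: no quorum yet at the late time ([Bp]), quorum already exceeded at the early
     time ([Bm]). *)
  pose Bp := [set omega | M ap omega <= theta].
  pose Bm := [set omega | theta < M am omega].
  have mM a : measurable_fun setT (M a) by apply: measurable_discovered_mass.
  have mBp : measurable Bp.
    have := mM ap measurableT _ (measurable_itv `]-oo, theta]).
    by rewrite setTI; congr (measurable _); apply/seteqP; split=> x /=; rewrite in_itv.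
  have mBm : measurable Bm.
    have := mM am measurableT _ (measurable_itv `]theta, +oo[).
    by rewrite setTI; congr (measurable _); apply/seteqP; split=> x /=; rewrite in_itv/= andbT.
  have PBp : (P N Bp <= (N%:R `^ (- (1 - s)) / ep ^+ 2)%:E)%E.
    apply: (discovered_mass_concentration lambda_gt0 s_ge0 ap0 ep0 N0 (T_indep N)) => //.
    move=> x; rewrite /Bp/= -/(M ap) => h; rewrite distrC.
    by apply: le_trans (ler_norm _); rewrite lerBrDl (le_trans _ hmp)// lerD2r.
  have PBm : (P N Bm <= (N%:R `^ (- (1 - s)) / em ^+ 2)%:E)%E.
    apply: (discovered_mass_concentration lambda_gt0 s_ge0 am0 em0 N0 (T_indep N)) => //.
    move=> x; rewrite /Bm/= -/(M am) => h.
    apply: le_trans (ler_norm _); rewrite lerBrDl -lerBrDr (le_trans hmm)// lerD2r.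
    exact: ltW.
  apply: (@le_trans _ _ (P N (Bp `|` Bm))).
    apply: le_measure; rewrite ?inE//.
    - have mD : measurable_fun setT (fun omega =>
          `|quorum_time (zipf s (N := N)) (T N) theta omega / N%:R - alpha / lambda|).
        by apply: measurableT_comp => //; apply: measurable_funB => //; exact: mX.
      have := mD measurableT _ (measurable_itv `]eps, +oo[).
      by rewrite setTI; congr (measurable _); apply/seteqP; split=> x /=; rewrite in_itv/= andbT.
    - exact: measurableU.
    move=> x /=; rewrite ltr_normr => /orP[h|h].
      (* Too late: a mass above [theta] at the late time would force the quorum time below
         (alpha/lambda + eps) N. *)
      left; rewrite /Bp/= leNgt; apply/negP => hM.
      have t0 : 0 <= ap * N%:R / lambda by rewrite divr_ge0 ?mulr_ge0 ?(ltW ap0)// ltW.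
      have := quorum_time_le t0 hM; apply/negP; rewrite -ltNge.
      have -> : ap * N%:R / lambda = (alpha / lambda + eps) * N%:R.
        rewrite /ap; field; exact: lt0r_neq0.
      by rewrite -ltr_pdivlMr// -ltrBrDl.
    right.
    (* Too early: the quorum is reached before the early time, and the mass stays above [theta] by
       monotonicity. *)
    have : quorum_time (zipf s (N := N)) (T N) theta x < am * N%:R / lambda.
      apply: (@lt_le_trans _ _ ((alpha / lambda - eps) * N%:R)).
        by rewrite -ltr_pdivrMr// ltrBrDl -ltrBrDr -opprB.
      have -> : (alpha / lambda - eps) * N%:R = (alpha - lambda * eps) * N%:R / lambda.
        field; exact: lt0r_neq0.
      by rewrite ler_pM2r ?invr_gt0// ler_pM2r// le_max lexx.
    move=> /(quorum_time_ltP _ _ _ (w1 _ N0))[u /andP[u0 ut] hu].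
    by apply: (lt_le_trans hu); apply: discovered_mass_le => //; exact: ltW.
  apply: le_trans (measureU2 _ mBp mBm) _.
  by rewrite /C mulrDr EFinD leeD.
apply: (squeeze_cvge bound); first exact: cvg_cst.
apply: cvg_EFin; first by near=> N.
rewrite -(mul0r C); apply: cvgM; last exact: cvg_cst.
by apply: powRN_cvg0; rewrite subr_gt0.
Unshelve. all: by end_near. Qed.
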